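(* The $\mathbb Q_N$-vector space $q\mathcal{MZ}_N$ is a subalgebra of $\mathcal{MD}_N$, i.e. it is closed under multiplication of formal power series.
   Context: $N\ge1$, $\eta=e^{2\pi i/N}$, $\mathbb Q_N=\mathbb Q(\eta)$, $\mathbb N=\{1,2,\dots\}$. For $d\ge 0$, $\mathbf s=(s_1,\dots,s_d)\in\mathbb N^d$, $\boldsymbol\alpha\in(\mathbb Z/N\mathbb Z)^d$ let $$[\mathbf s;\boldsymbol\alpha]=\frac{1}{\prod_j(s_j-1)!}\sum_{n\ge1}\Bigg(\sum_{\substack{u_1v_1+\cdots+u_dv_d=n\\ u_1>\cdots>u_d>0,\ v_j\ge1}}\eta^{\sum_j\alpha_jv_j}\prod_j v_j^{s_j-1}\Bigg)q^n\in\mathbb Q_N[[q]],$$ $[\emptyset]=1$, and $\mathcal{MD}_N$ the $\mathbb Q_N$-span of all of these. For $1\le\beta<N$ and any $(\mathbf s;\boldsymbol\alpha)$ (possibly empty) put $g_\beta(\mathbf s;\boldsymbol\alpha)=[1,\mathbf s;0,\boldsymbol\alpha]-[1,\mathbf s;\beta,\boldsymbol\alpha]$. $q\mathcal{MZ}_N$ is the $\mathbb Q_N$-span of all $[\mathbf s;\boldsymbol\alpha]$ with $d\ge1$ and $s_1>1$ (together with $[\emptyset]=1$) and all $g_\beta(\mathbf s;\boldsymbol\alpha)$, $1\le\beta<N$, $d\ge0$. *)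

(* Defs.v *)
From mathcomp Require Import all_boot all_order all_algebra.
From mathcomp Require Import classical_sets reals trigo.
From mathcomp.real_closed Require Import complex.
Set Implicit Arguments.
Unset Strict Implicit.
Unset Printing Implicit Defensive.
Import Order.TTheory GRing.Theory Num.Theory.
Local Open Scope classical_set_scope.
Local Open Scope ring_scope.

(* The index (s_1, ..., s_d; a_1, ..., a_d) is the list of the pairs
   (s_j, a_j), so that d is its length. For N >= 1 the type 'I_N.-1.+1 is Z/NZ:
   the residues 0, ..., N-1, where 0 is the zero class. 'Z_N is not used
   because 'Z_1 is Z/2Z. *)
Definition word (N : nat) : Type := seq (nat * 'I_N.-1.+1).

Definition positive_word (N : nat) (w : word N) : bool :=
  all (fun l => 0 < l.1)%N w.

(* A formal power series f in C[[q]] is its coefficient sequence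
   n |-> f n; the complex numbers are R[i] for the reals R. *)
Definition fps (R : realType) : Type := nat -> R[i].

Definition fps_one (R : realType) : fps R := fun n => (n == 0)%:R.

Definition fps_add (R : realType) (f g : fps R) : fps R :=
  fun n => f n + g n.

Definition fps_scale (R : realType) (c : R[i]) (f : fps R) : fps R :=
  fun n => c * f n.

Definition fps_mul (R : realType) (f g : fps R) : fps R :=
  fun n => \sum_(i < n.+1) f i * g (n - i)%N.

Definition eta (R : realType) (N : nat) : R[i] :=
  (cos (2 * pi / N%:R) +i* sin (2 * pi / N%:R))%C.

(* Q(eta), as the least subfield of the complex numbers containing eta. *)
Definition QN (R : realType) (N : nat) : set R[i] :=
  [set x | forall S : {pred R[i]},
      divring_closed S -> eta R N \in S -> x \in S].
Arguments QN R N : clear implicits.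

(* u_j v_j <= n and u_j, v_j >= 1 force u_j, v_j <= n, hence the ranges of u
   and v. At n = 0 the sum is empty if d >= 1, and it is 1 if d = 0
   (see bracket_nil and bracket_coef0). *)
Definition bracket (R : realType) (N : nat) (w : word N) : fps R := fun n =>
  let d := size w in
  let s (j : 'I_d) : nat := (tnth (in_tuple w) j).1 in
  let a (j : 'I_d) : 'I_N.-1.+1 := (tnth (in_tuple w) j).2 in
  (\prod_(j < d) ((s j).-1)`!%:R)^-1 *
  \sum_(u : {ffun 'I_d -> 'I_n.+1})
    \sum_(v : {ffun 'I_d -> 'I_n.+1} |
            [&& (\sum_(j < d) u j * v j == n)%N,
                [forall i : 'I_d, forall j : 'I_d, (i < j)%N ==> (u j < u i)%N],
                [forall j : 'I_d, (0 < u j)%N] &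
                [forall j : 'I_d, (0 < v j)%N]])
      eta R N ^+ (\sum_(j < d) a j * v j)%N *
      \prod_(j < d) (v j)%:R ^+ (s j).-1.

Definition gbeta (R : realType) (N : nat) (beta : 'I_N.-1.+1) (w : word N) :
    fps R :=
  fun n => bracket R ((1%N, 0) :: w) n - bracket R ((1%N, beta) :: w) n.

Definition QN_span (R : realType) (N : nat) (G : set (fps R)) : set (fps R) :=
  [set f | exists (m : nat) (c : 'I_m -> R[i]) (g : 'I_m -> fps R),
      [/\ forall i, QN R N (c i),
          forall i, G (g i) &
          f = fun n => \sum_(i < m) c i * g i n]].

Definition MD (R : realType) (N : nat) : set (fps R) :=
  QN_span N [set f | exists w : word N,
                       positive_word w /\ f = bracket R w].

Definition qMZ_gen (R : realType) (N : nat) : set (fps R) :=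
  [set f | f = bracket R ([::] : word N)] `|`
  [set f | exists (s1 : nat) (a1 : 'I_N.-1.+1) (w : word N),
             [/\ (1 < s1)%N, positive_word w &
                 f = bracket R ((s1, a1) :: w)]] `|`
  [set f | exists (beta : 'I_N.-1.+1) (w : word N),
             [/\ beta != 0, positive_word w & f = gbeta R beta w]].

Arguments qMZ_gen R N : clear implicits.

Definition qMZ (R : realType) (N : nat) : set (fps R) :=
  QN_span N (qMZ_gen R N).
Arguments MD R N : clear implicits.
Arguments qMZ R N : clear implicits.

(* A is a unital subalgebra, over Q(eta), of the space B of power series. *)
Definition QN_subalgebra (R : realType) (N : nat) (A B : set (fps R)) : Prop :=
  [/\ A `<=` B,
      A (fps_one R),
      forall f g, A f -> A g -> A (fps_add f g),
      forall c f, QN R N c -> A f -> A (fps_scale c f) &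
      forall f g, A f -> A g -> A (fps_mul f g)].

Lemma bracket_nil (R : realType) (N : nat) (n : nat) :
  bracket R ([::] : word N) n = fps_one R n.
Proof.
rewrite /bracket /fps_one /= big_ord0 invr1 mul1r.
have e (F : {ffun 'I_0 -> 'I_n.+1} -> R[i]) :
    \sum_u F u = F [ffun => ord0].
  rewrite (bigD1 [ffun => ord0]) //= big1 ?addr0 // => u /eqP[].
  by apply/ffunP => -[].
rewrite e big_mkcond /= e !big_ord0 expr0 mulr1.
have t (P : pred 'I_0) : [forall j, P j] by apply/forallP => -[].
by rewrite !t !andbT eq_sym; case: eqP.
Qed.

Lemma bracket_coef0 (R : realType) (N : nat) l (w : word N) :
  bracket R (l :: w) 0%N = 0.
Proof.
rewrite /bracket [X in _ * X]big1 ?mulr0 // => u _; rewrite big_pred0 // => v.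
apply/negbTE/negP => /and4P[_ _ /forallP/(_ ord0) + _].
by rewrite ltnNge leq_ord.
Qed.

(* Main.v *)
Require Import Defs.
From HB Require Import structures.
From mathcomp Require Import all_boot all_order all_algebra ring.
From mathcomp Require Import boolp classical_sets functions reals trigo.
From mathcomp.real_closed Require Import complex.
Set Implicit Arguments.
Unset Strict Implicit.
Unset Printing Implicit Defensive.
Import Order.TTheory GRing.Theory Num.Theory.
Local Open Scope ring_scope.

(* Write [s; alpha] as the sum over u_1 > ... > u_d > 0 of the products of
   a_j(q^(u_j)), where the letter a_j has the coefficients
   eta^(alpha_j n) n^(s_j - 1) / (s_j - 1)! for n >= 1. Splitting double sums
   gives a quasi-shuffle product, in which two letters merge into their product
   as power series. That product is again a combination of letters, because a
   convolution of exponential polynomials is one. The generators of qMZ are the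
   sums whose outermost letter is an exponential polynomial vanishing when
   extrapolated to n = 0. Up to sign, this extrapolation is the value at
   infinity of a rational function, hence multiplicative, so merging keeps the
   outermost letter in the kernel. *)

(** * The algebra of formal power series *)

Section PowerSeries.
Context {R : realType}.
Implicit Types (f g h : fps R) (c : R[i]).

HB.instance Definition _ := Choice.copy (fps R) (nat -> R[i]).

Lemma fps_addA : associative (@fps_add R).
Proof. by move=> f g h; apply/funext => n; rewrite /fps_add addrA. Qed.

Lemma fps_addC : commutative (@fps_add R).
Proof. by move=> f g; apply/funext => n; rewrite /fps_add addrC. Qed.

Lemma fps_add0 : left_id ((fun=> 0) : fps R) (@fps_add R).
Proof. by move=> f; apply/funext => n; rewrite /fps_add add0r. Qed.

Lemma fps_addN :
  left_inverse ((fun=> 0) : fps R) (fun f n => - f n) (@fps_add R).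
Proof. by move=> f; apply/funext => n; rewrite /fps_add addNr. Qed.

HB.instance Definition _ :=
  GRing.isZmodule.Build (fps R) fps_addA fps_addC fps_add0 fps_addN.

(** Up to degree [m] a product depends only on truncations at [m], so the ring laws are inherited
    from polynomials. *)
Lemma fps_mul_poly f g n m : (n <= m)%N ->
  fps_mul f g n = (\poly_(i < m.+1) f i * \poly_(i < m.+1) g i)`_n.
Proof.
move=> nm; rewrite coefM; apply: eq_bigr => i _.
by rewrite !coef_poly !ltnS (leq_trans (leq_subr _ _) nm) (leq_trans (leq_ord i)).
Qed.

Lemma fps_mulC : commutative (@fps_mul R).
Proof. by move=> f g; apply/funext => n; rewrite !(fps_mul_poly _ _ (leqnn n)) mulrC. Qed.

Lemma fps_mulA : associative (@fps_mul R).
Proof.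
move=> f g h; apply/funext => n.
pose t (k : fps R) := \poly_(i < n.+1) k i.
(* [t (fps_mul k l)] and [t k * t l] agree up to degree [n], so they are interchangeable inside a
   coefficient of degree [n]. *)
have e (p : {poly R[i]}) (k l : fps R) :
    (p * t (fps_mul k l))`_n = (p * (t k * t l))`_n.
  rewrite !coefM; apply: eq_bigr => i _.
  by rewrite coef_poly ltnS leq_subr (fps_mul_poly _ _ (leq_subr i n)).
rewrite !(fps_mul_poly _ _ (leqnn n)) -!/(t _) e mulrA.
by rewrite [RHS](congr1 (fun p : {poly _} => p`_n) (mulrC _ _)) e mulrC.
Qed.

Lemma fps_mul1 : left_id (@fps_one R) (@fps_mul R).
Proof.
move=> f; apply/funext => n; rewrite /fps_mul big_ord_recl /fps_one /= mul1r subn0.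
by rewrite big1 ?addr0 // => i _; rewrite mul0r.
Qed.

Lemma fps_mulDl : left_distributive (@fps_mul R) (@fps_add R).
Proof.
move=> f g h; apply/funext => n; rewrite /fps_mul /fps_add -big_split /=.
by apply: eq_bigr => i _; rewrite mulrDl.
Qed.

Lemma fps_one_neq0 : fps_one R != 0.
Proof. by apply/eqP => /(congr1 (fun f => f 0%N)) /eqP; rewrite oner_eq0. Qed.

HB.instance Definition _ := GRing.Zmodule_isComNzRing.Build (fps R)
  fps_mulA fps_mulC fps_mul1 fps_mulDl fps_one_neq0.

Lemma fps_scaleA a b f : fps_scale a (fps_scale b f) = fps_scale (a * b) f.
Proof. by apply/funext => n; rewrite /fps_scale mulrA. Qed.

Lemma fps_scale1 : left_id 1 (@fps_scale R).
Proof. by move=> f; apply/funext => n; rewrite /fps_scale mul1r. Qed.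

Lemma fps_scaleDr : right_distributive (@fps_scale R) +%R.
Proof.
move=> c f g; apply/funext => n.
by rewrite /fps_scale /GRing.add /= /fps_add mulrDr.
Qed.

Lemma fps_scaleDl f : {morph (@fps_scale R)^~ f : a b / a + b}.
Proof. by move=> a b; apply/funext => n; rewrite /fps_scale mulrDl. Qed.

HB.instance Definition _ := GRing.Zmodule_isLmodule.Build R[i] (fps R)
  fps_scaleA fps_scale1 fps_scaleDr fps_scaleDl.

Lemma fps_scaleAl c f g : c *: (f * g) = c *: f * g.
Proof.
apply/funext => n; rewrite [LHS]mulr_sumr.
by apply: eq_bigr => i _; rewrite mulrA.
Qed.

HB.instance Definition _ :=
  GRing.Lmodule_isLalgebra.Build R[i] (fps R) fps_scaleAl.

Lemma fps_scaleAr c f g : c *: (f * g) = f * (c *: g).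
Proof. by rewrite mulrC fps_scaleAl mulrC. Qed.

HB.instance Definition _ :=
  GRing.Lalgebra_isAlgebra.Build R[i] (fps R) fps_scaleAr.

Lemma fpsD f g n : (f + g) n = f n + g n. Proof. by []. Qed.
Lemma fpsB f g n : (f - g) n = f n - g n. Proof. by []. Qed.
Lemma fps0 n : (0 : fps R) n = 0. Proof. by []. Qed.
Lemma fpsZ c f n : (c *: f) n = c * f n. Proof. by []. Qed.
Lemma fpsM f g n : (f * g) n = \sum_(i < n.+1) f i * g (n - i)%N.
Proof. by []. Qed.
Lemma fps_sum I (r : seq I) (P : pred I) (F : I -> fps R) n :
  (\sum_(i <- r | P i) F i) n = \sum_(i <- r | P i) F i n.
Proof. by elim/big_rec2: _ => [|i y1 y2 _ <-]. Qed.

End PowerSeries.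

(** * Linear spans over Q(eta) in complex modules *)

Section Span.
Context {R : realType} {N : nat}.
Local Notation K := (QN R N).
Implicit Types c d : R[i].

Lemma QN1 : K 1. Proof. by move=> S [S1 _ _] _. Qed.
Lemma QNB c d : K c -> K d -> K (c - d).
Proof.
move=> Kc Kd S dS eS; case: (dS) => _ SB _.
by apply: SB; [apply: Kc|apply: Kd].
Qed.

Lemma QN_div c d : K c -> K d -> K (c / d).
Proof.
move=> Kc Kd S dS eS; case: (dS) => _ _ SD.
by apply: SD; [apply: Kc|apply: Kd].
Qed.

Lemma QN_eta : K (Defs.eta R N). Proof. by []. Qed.
Lemma QN0 : K 0. Proof. by rewrite -(subrr 1); apply: QNB QN1 QN1. Qed.
Lemma QNN c : K c -> K (- c). Proof. by move=> Kc; rewrite -sub0r; apply: QNB QN0 Kc. Qed.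
Lemma QND c d : K c -> K d -> K (c + d).
Proof. by move=> Kc Kd; rewrite -[d]opprK; apply/QNB/QNN. Qed.
Lemma QNV c : K c -> K c^-1.
Proof. by move=> Kc; rewrite -div1r; apply: QN_div QN1 Kc. Qed.
Lemma QNM c d : K c -> K d -> K (c * d).
Proof. by move=> Kc Kd; rewrite -[d]invrK; apply/QN_div/QNV. Qed.
Lemma QNX c n : K c -> K (c ^+ n).
Proof. by move=> Kc; elim: n => [|n IH]; [exact: QN1|rewrite exprS; apply: QNM]. Qed.
Lemma QN_nat n : K n%:R.
Proof. by elim: n => [|n IH]; [exact: QN0|rewrite -natr1; apply: QND IH QN1]. Qed.

(** Adding one generator at a time makes linearity arguments inductions. A general [V] covers both
    power series and sequences of power series. *)
Inductive qspan (V : lmodType R[i]) (G : V -> Prop) : V -> Prop :=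
| qspan0 : qspan G 0
| qspan_cons c g f : K c -> G g -> qspan G f -> qspan G (c *: g + f).

Definition submodule (V : lmodType R[i]) (P : V -> Prop) : Prop :=
  [/\ P 0, forall u v, P u -> P v -> P (u + v) &
      forall c u, K c -> P u -> P (c *: u)].

Section Theory.
Context {V : lmodType R[i]}.
Implicit Types (G P : V -> Prop) (u v : V).

Lemma qspan_submodule G : submodule (qspan G).
Proof.
split=> [|u v Gu Gv|c u Kc]; first exact: qspan0.
  by elim: Gu => [|c g f Kc Gg _ IH]; rewrite ?add0r // -addrA; apply: qspan_cons.
elim=> [|d g f Kd Gg _ IH]; first by rewrite scaler0; apply: qspan0.
by rewrite scalerDr scalerA; apply: qspan_cons => //; apply: QNM.
Qed.

Lemma qspan_gen G u : G u -> qspan G u.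
Proof.
by move=> Gu; rewrite -[u]addr0 -[u]scale1r; apply: qspan_cons QN1 Gu (qspan0 G).
Qed.

Lemma qspan_sub G P : submodule P -> (forall g, G g -> P g) ->
  forall u, qspan G u -> P u.
Proof.
move=> [P0 PD PZ] GP u; elim=> // c g f Kc Gg _ Pf.
by apply: PD => //; apply: PZ => //; apply: GP.
Qed.

Section Closed.
Context {P : V -> Prop} (sP : submodule P).

Lemma submod0 : P 0. Proof. by case: sP. Qed.
Lemma submodD u v : P u -> P v -> P (u + v). Proof. by case: sP => _ + _; apply. Qed.
Lemma submodZ c u : K c -> P u -> P (c *: u). Proof. by case: sP => _ _; apply. Qed.
Lemma submodB u v : P u -> P v -> P (u - v).
Proof.
move=> Pu Pv; apply: submodD => //; rewrite -scaleN1r; apply: submodZ => //.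
exact: QNN QN1.
Qed.
Lemma submod_sum I (r : seq I) (Q : pred I) (F : I -> V) :
  (forall i, Q i -> P (F i)) -> P (\sum_(i <- r | Q i) F i).
Proof. by move=> QP; elim/big_ind: _ => //; [exact: submod0|exact: submodD]. Qed.
End Closed.

End Theory.

End Span.
Arguments qspan {R} N {V} G _.
Arguments submodule {R} N {V} P.

(** Combined with [qspan_sub], this reduces a claim that is linear in its argument to generators;
    bilinear claims are treated one argument at a time. *)
Lemma submodule_preim (R : realType) N (U V : lmodType R[i]) (F : U -> V)
    (P : V -> Prop) :
  submodule N P -> F 0 = 0 -> {morph F : u v / u + v} ->
  (forall c, {morph F : u / c *: u}) -> submodule N (fun u => P (F u)).
Proof.
move=> [P0 PD PZ] F0 FD FZ; split=> [|u v Pu Pv|c u Kc Pu]; first by rewrite F0.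
  by rewrite FD; apply: PD.
by rewrite FZ; apply: PZ.
Qed.

Lemma QN_spanP (R : realType) N (G : set (fps R)) f :
  QN_span N G f <-> qspan N G f.
Proof.
split=> [[m [c [g [Kc Gg ->]]]]|].
  rewrite (_ : (fun n => _) = \sum_(i < m) c i *: g i); last first.
    by apply/funext => n; rewrite fps_sum.
  apply: (submod_sum (qspan_submodule G)) => i _.
  by apply: (submodZ (qspan_submodule G)) (Kc i) _; apply: qspan_gen.
elim=> [|c g h Kc Gg _ [m [d [k [Kd Gk ->]]]]].
  exists 0%N, (fun=> 0), (fun=> 0); split=> [i|i|]; [by case: i|by case: i|].
  by apply/funext => n; rewrite big_ord0.
exists m.+1, (fun i => oapp d c (unlift ord0 i)), (fun i => oapp k g (unlift ord0 i)).
split=> [i|i|]; try by case: unliftP => [j _|_] /=.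
apply/funext => n; rewrite big_ord_recl unlift_none /=.
by under [in RHS]eq_bigr do rewrite liftK /=.
Qed.

(** * Convolutions of a geometric sequence with an exponential monomial *)

Section GeometricSums.
Context {C : numFieldType}.
Implicit Types (z x : C).

Definition geosum z x b n : C := \sum_(w < n) z ^+ (n - w) * (x ^+ w * w%:R ^+ b).

Lemma geosumS z x b n : geosum z x b n.+1 = z * (geosum z x b n + x ^+ n * n%:R ^+ b).
Proof.
rewrite /geosum big_ord_recr /= subSnn expr1 mulrDr; congr (_ + _).
rewrite mulr_sumr; apply: eq_bigr => i _.
by rewrite subSn ?exprS ?mulrA // ltnW.
Qed.

Lemma exprS_binomial b n :
  (n.+1%:R : C) ^+ b = n%:R ^+ b + \sum_(k < b) n%:R ^+ k *+ 'C(b, k).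
Proof.
rewrite -natr1 addrC exprDn big_ord_recr /= binn mulr1n subnn expr0 mul1r addrC.
by congr (_ + _); apply: eq_bigr => i _; rewrite expr1n mul1r.
Qed.

(** Summation by parts: (w + 1)^b - w^b has degree below b, so the sum telescopes up to sums with
    smaller exponents. The term with [0 ^+ b] is the boundary term at w = 0. *)
Lemma geosum_neq z x b n :
  (x - z) * geosum z x b n =
    z * (x ^+ n * n%:R ^+ b - z ^+ n * 0 ^+ b)
    - x * \sum_(k < b) geosum z x k n *+ 'C(b, k).
Proof.
elim: n => [|n IH].
  rewrite /geosum !big_ord0 !expr0 !mul1r subrr !mulr0 big1 ?mulr0 ?subr0 // => k _.
  by rewrite big_ord0 mul0rn.
under eq_bigr do rewrite geosumS -mulrnAr mulrnDl.
rewrite -mulr_sumr big_split /= geosumS.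
rewrite exprS_binomial !exprS.
set A := \sum_(k < b) _ in IH *; set B := \sum_(k < b) n%:R ^+ k *+ _.
have -> : \sum_(k < b) x ^+ n * n%:R ^+ k *+ 'C(b, k) = x ^+ n * B.
  by rewrite mulr_sumr; apply: eq_bigr => k _; rewrite mulrnAr.
have -> : (x - z) * (z * (geosum z x b n + x ^+ n * n%:R ^+ b)) =
  z * ((x - z) * geosum z x b n) + (x - z) * (z * (x ^+ n * n%:R ^+ b)) by ring.
by rewrite IH; ring.
Qed.

(** For equal bases the left side of [geosum_neq] at exponent [b.+1] vanishes, and the last summand,
    with binomial coefficient b + 1, can be isolated. *)
Lemma geosum_eq z b n : z != 0 ->
  b.+1%:R * geosum z z b n =
    z ^+ n * n%:R ^+ b.+1 - \sum_(k < b) geosum z z k n *+ 'C(b.+1, k).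
Proof.
move=> z0; apply: (mulfI z0); have := geosum_neq z z b.+1 n.
rewrite subrr mul0r big_ord_recr /= binSn [0 ^+ _]exprS mul0r mulr0 subr0.
move=> /eqP; rewrite eq_sym subr_eq0 => /eqP; rewrite mulrBr => ->.
by rewrite mulrDr [X in X - _]addrC addrK mulr_natl.
Qed.
End GeometricSums.

(** * Exponential polynomials and their products as power series *)

Section Letters.
Context {R : realType} {N : nat}.
Local Notation K := (QN R N).
Local Notation residue := 'I_N.-1.+1.
Implicit Types (f g h : fps R) (a b : residue) (k l n : nat).

Lemma eta_neq0 : Defs.eta R N != 0.
Proof.
apply/eqP => -[c0 s0]; have /eqP := cos2Dsin2 (2 * pi / N%:R : R).
by rewrite c0 s0 expr0n addr0 eq_sym oner_eq0.
Qed.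

Definition zeta a : R[i] := Defs.eta R N ^+ a.

Lemma zeta_neq0 a : zeta a != 0. Proof. by rewrite expf_neq0 ?eta_neq0. Qed.
Lemma QN_zeta a : K (zeta a). Proof. exact/QNX/QN_eta. Qed.

Definition monomial k a : fps R := fun n => zeta a ^+ n * n%:R ^+ k.

(** Here k stands for s - 1. The value at n = 0, where 0^0 = 1, is the extrapolated one; only the
    positive part enters the nested sums. *)
Definition letter k a : fps R := (k`!%:R)^-1 *: monomial k a.

Definition expoly : fps R -> Prop := qspan N (fun f => exists k a, f = letter k a).

Lemma expoly_submodule : submodule N expoly.
Proof. exact: qspan_submodule. Qed.

Lemma expoly_letter k a : expoly (letter k a).
Proof. by apply: qspan_gen; exists k, a. Qed.

Lemma fact_neq0 k : k`!%:R != 0 :> R[i].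
Proof. by rewrite pnatr_eq0 -lt0n fact_gt0. Qed.

Lemma expoly_monomial k a : expoly (monomial k a).
Proof.
have -> : monomial k a = k`!%:R *: letter k a.
  by rewrite scalerA divff ?fact_neq0 // scale1r.
by apply: (submodZ expoly_submodule) (QN_nat _) (expoly_letter _ _).
Qed.

(** Strong induction on [k]: for equal roots of unity [geosum_eq] is divided by k + 1, otherwise
    [geosum_neq] by their difference. Both divisors lie in Q(eta). *)
Lemma expoly_geosum a b k : expoly (geosum (zeta a) (zeta b) k).
Proof.
elim/ltn_ind: k => k IH; have [ab|ab] := eqVneq (zeta a) (zeta b).
  have k0 : (k.+1%:R : R[i]) != 0 by rewrite pnatr_eq0.
  have -> : geosum (zeta a) (zeta b) k = k.+1%:R^-1 *: (monomial k.+1 b -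
      \sum_(i < k) 'C(k.+1, i)%:R *: (geosum (zeta a) (zeta b) i : fps R)).
    apply/funext => n; rewrite ab fpsZ fpsB fps_sum; apply: (mulfI k0).
    rewrite geosum_eq ?zeta_neq0 // mulVKf //.
    by congr (_ - _); apply: eq_bigr => i _; rewrite fpsZ mulr_natl.
  apply: (submodZ expoly_submodule) => //; first exact/QNV/QN_nat.
  apply: (submodB expoly_submodule) (expoly_monomial _ _) _ => //.
  apply: (submod_sum expoly_submodule) => i _.
  by apply: (submodZ expoly_submodule) (QN_nat _) (IH i _).
rewrite eq_sym -subr_eq0 in ab.
have -> : geosum (zeta a) (zeta b) k = (zeta b - zeta a)^-1 *:
    (zeta a *: (monomial k b - 0 ^+ k *: monomial 0 a) -
     zeta b *: \sum_(i < k) 'C(k, i)%:R *: (geosum (zeta a) (zeta b) i : fps R)).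
  apply/funext => n; rewrite fpsZ fpsB !fpsZ fpsB fpsZ fps_sum; apply: (mulfI ab).
  rewrite geosum_neq // mulVKf // /monomial expr0 mulr1 [0 ^+ k * _]mulrC.
  by congr (_ - _ * _); apply: eq_bigr => i _; rewrite fpsZ mulr_natl.
apply: (submodZ expoly_submodule) => //; first by apply/QNV/QNB; apply: QN_zeta.
apply: (submodB expoly_submodule); apply: (submodZ expoly_submodule) (QN_zeta _) _.
  apply: (submodB expoly_submodule) (expoly_monomial _ _) _ => //.
  by apply: (submodZ expoly_submodule) (expoly_monomial _ _) => //; apply/QNX/QN0.
apply: (submod_sum expoly_submodule) => i _.
by apply: (submodZ expoly_submodule) (QN_nat _) (IH i _).
Qed.

Definition pospart f : fps R := fun n => if n is 0 then 0 else f n.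

Lemma pospartD : {morph pospart : f g / f + g}.
Proof. by move=> f g; apply/funext => -[|n] //; rewrite fpsD addr0. Qed.

Lemma pospartZ c : {morph pospart : f / c *: f}.
Proof. by move=> f; apply/funext => -[|n] //; rewrite fpsZ mulr0. Qed.

Lemma pospart0 : pospart 0 = 0.
Proof. by apply/funext => -[]. Qed.

Lemma pospartB : {morph pospart : f g / f - g}.
Proof. by move=> f g; rewrite pospartD -scaleN1r pospartZ scaleN1r. Qed.

(** The Euler derivation q d/dq. *)
Definition theta f : fps R := fun n => n%:R * f n.

Lemma thetaM f g : theta (f * g) = theta f * g + f * theta g.
Proof.
apply/funext => n; rewrite fpsD !fpsM -big_split /theta mulr_sumr /=.
apply: eq_bigr => i _; rewrite -{1}(subnK (leq_ord i)) natrD; ring.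
Qed.

Lemma theta_pospart f : theta (pospart f) = pospart (theta f).
Proof. by apply/funext => -[|n] //; rewrite /theta mulr0. Qed.

Lemma theta_monomial k a : theta (monomial k a) = monomial k.+1 a.
Proof. by apply/funext => n; rewrite /theta /monomial exprS mulrCA. Qed.

Lemma expoly_theta f : expoly f -> expoly (theta f).
Proof.
have sP : submodule N (fun f => expoly (theta f)).
  apply: submodule_preim expoly_submodule _ _ _ => [|f1 f2|c f1]; apply/funext => n.
  - by rewrite /theta mulr0.
  - by rewrite /theta mulrDr.
  by rewrite /theta !fpsZ mulrCA.
apply: (qspan_sub sP) => _ [k [a ->]].
have -> : theta (letter k a) = (k`!%:R)^-1 *: monomial k.+1 a.
  by rewrite -theta_monomial; apply/funext => n; rewrite /theta !fpsZ mulrCA.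
by apply: (submodZ expoly_submodule) (expoly_monomial _ _) => //; apply/QNV/QN_nat.
Qed.

(* The minus sign: extrapolated to [n = 0], the convolution over the indices
   strictly between [0] and [n] is minus the product of the values at [0], as
   the product of the values at infinity of two rational functions. *)
Definition expoly_prod f g : Prop :=
  exists h, [/\ expoly h, pospart f * pospart g = pospart h & h 0%N = - (f 0%N * g 0%N)].

Lemma expoly_prodC f g : expoly_prod f g -> expoly_prod g f.
Proof. by move=> [h [? ? ?]]; exists h; split; rewrite // mulrC. Qed.

Lemma expoly_prod_submodule f : submodule N (expoly_prod f).
Proof.
split=> [|g1 g2 [h1 [E1 M1 Z1]] [h2 [E2 M2 Z2]]|c g Kc [h [E1 M1 Z1]]].
- exists 0; rewrite pospart0 !fps0 !mulr0 oppr0; split=> //.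
  exact: (submod0 expoly_submodule).
- exists (h1 + h2); split; first exact: (submodD expoly_submodule).
    by rewrite !pospartD mulrDr M1 M2.
  by rewrite !fpsD Z1 Z2 mulrDr opprD.
exists (c *: h); split; first exact: (submodZ expoly_submodule).
  by rewrite !pospartZ -scalerAr M1.
by rewrite !fpsZ Z1 mulrCA mulrN.
Qed.

(** Induction on [k]: [theta] is a derivation raising the exponent of a monomial, so a unit of
    exponent moves from one factor to the other by the Leibniz rule. *)
Lemma expoly_prod_monomial k a l b : expoly_prod (monomial k a) (monomial l b).
Proof.
elim: k l => [|k IH] l.
  (* [geosum] also contains the term w = 0, absent from a product of positive parts. Subtracting it
     yields the value -0^l at n = 0, where [geosum] is an empty sum. *)
  exists ((geosum (zeta a) (zeta b) l : fps R) - 0 ^+ l *: monomial 0 a); split.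
  - apply: (submodB expoly_submodule) (expoly_geosum _ _ _) _ => //.
    by apply: (submodZ expoly_submodule) (expoly_monomial _ _) => //; apply/QNX/QN0.
  - rewrite mulrC; apply/funext => -[|n].
      by rewrite fpsM big_ord_recl big_ord0 mul0r addr0.
    rewrite fpsM big_ord_recr big_ord_recl /= mul0r add0r subnn mulr0 addr0.
    rewrite fpsB fpsZ /geosum big_ord_recl /monomial /= expr0 mul1r mulr1 subn0.
    rewrite [X in X - _]addrC [0 ^+ l * _]mulrC addrK; apply: eq_bigr => i _.
    by rewrite subSS -(subnSK (ltn_ord i)) /= expr0 mulr1 mulrC.
  by rewrite fpsB fpsZ /geosum big_ord0 /monomial !expr0 !mulr1 !mul1r sub0r.
have [h [Eh Mh Zh]] := IH l; have [g [Eg Mg Zg]] := IH l.+1.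
exists (theta h - g); split.
- by apply: (submodB expoly_submodule) => //; apply: expoly_theta.
- rewrite pospartB -theta_pospart -Mh -Mg thetaM !theta_pospart !theta_monomial.
  by rewrite addrK.
by rewrite fpsB Zg /theta /monomial !exprS !(mul0r, mulr0, subr0, oppr0, sub0r).
Qed.

Lemma expoly_mul f g : expoly f -> expoly g -> expoly_prod f g.
Proof.
move=> Ef; move: g; apply: qspan_sub => [|_ [l [b ->]]].
  exact: expoly_prod_submodule.
apply: (submodZ (expoly_prod_submodule _)) (QNV (QN_nat _)) _.
apply/expoly_prodC; move: f Ef; apply: qspan_sub => [|_ [k [a ->]]].
  exact: expoly_prod_submodule.
apply: (submodZ (expoly_prod_submodule _)) (QNV (QN_nat _)) _.
exact: expoly_prod_monomial.
Qed.

End Letters.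

(** * The summation operator and its quasi-shuffle relation *)

Section RotaBaxter.
Context {R : realType}.
Implicit Types (a b f g : fps R) (X Y W : nat -> fps R) (k n : nat).

(** The substitution f(q^k). *)
Definition dilate k f : fps R := fun n => if (k %| n)%N then f (n %/ k)%N else 0.

Lemma dilateD k : {morph dilate k : f g / f + g}.
Proof.
by move=> f g; apply/funext => n; rewrite /dilate !fpsD; case: ifP; rewrite ?addr0.
Qed.

Lemma dilateZ k c : {morph dilate k : f / c *: f}.
Proof.
by move=> f; apply/funext => n; rewrite /dilate !fpsZ; case: ifP; rewrite ?mulr0.
Qed.

Lemma dilate0 k : dilate k 0 = 0.
Proof. by apply/funext => n; rewrite /dilate; case: ifP. Qed.

(** Only indices i divisible by [k] contribute to the convolution; none survives unless [k] divides
    n, and then i = jk reindexes the sum. *)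
Lemma dilateM k : (0 < k)%N -> {morph dilate k : f g / f * g}.
Proof.
move=> k0 f g; apply/funext => n; rewrite fpsM {1}/dilate; case: ifPn => kn; last first.
  rewrite big1 // => i _; rewrite /dilate; case: ifP => [ki|]; last by rewrite mul0r.
  by rewrite dvdn_subl ?leq_ord // (negPf kn) mulr0.
case/dvdnP: kn => m ->; rewrite mulnK // fpsM.
rewrite -(big_mkord xpredT (fun i => dilate k f i * dilate k g (m * k - i)%N)).
rewrite (bigID (fun i => (k %| i)%N)) /= [X in _ + X]big1 ?addr0; last first.
  by move=> i /negPf ki; rewrite /dilate ki mul0r.
rewrite -(big_mkord xpredT (fun i => f i * g (m - i)%N)).
transitivity (\sum_(i <- map (muln^~ k) (index_iota 0 m.+1))
    dilate k f i * dilate k g (m * k - i)%N).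
  rewrite big_map; apply: eq_bigr => i _.
  by rewrite /dilate -mulnBl !dvdn_mull // !mulnK.
rewrite -[RHS]big_filter; apply: perm_big; apply: uniq_perm.
- by rewrite map_inj_uniq ?iota_uniq // => i j /eqP; rewrite eqn_pmul2r // => /eqP.
- by rewrite filter_uniq ?iota_uniq.
move=> i; rewrite mem_filter mem_index_iota; apply/mapP/andP => [[j]|[/dvdnP[j ->]]].
  rewrite mem_index_iota /= => /ltnSE jm ->; split; first exact: dvdn_mull.
  by rewrite ltnS leq_pmul2r.
by rewrite /= ltnS leq_pmul2r // => jm; exists j; rewrite ?mem_index_iota ?ltnS.
Qed.

Lemma seqD X Y m : (X + Y) m = X m + Y m. Proof. by []. Qed.
Lemma seqM X Y m : (X * Y) m = X m * Y m. Proof. by []. Qed.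
Lemma seqZ c X m : (c *: X) m = c *: X m. Proof. by []. Qed.

(* [integral a X m] is the sum of [a(q^u) X_(u-1)] over [1 <= u <= m]. *)
Definition integral a X m : fps R := \sum_(k < m) dilate k.+1 a * X k.

Lemma integral_0 a X : integral a X 0 = 0.
Proof. exact: big_ord0. Qed.

Lemma integralS a X m :
  integral a X m.+1 = integral a X m + dilate m.+1 a * X m.
Proof. exact: big_ord_recr. Qed.

Lemma integralDl X : {morph integral^~ X : a b / a + b}.
Proof.
move=> a b; apply/funext => m; rewrite seqD /integral -big_split /=.
by apply: eq_bigr => k _; rewrite dilateD mulrDl.
Qed.

Lemma integralZl X c : {morph integral^~ X : a / c *: a}.
Proof.
move=> a; apply/funext => m; rewrite seqZ /integral scaler_sumr.
by apply: eq_bigr => k _; rewrite dilateZ scalerAl.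
Qed.

Lemma integral0l X : integral 0 X = 0.
Proof. by apply/funext => m; rewrite /integral big1 // => k _; rewrite dilate0 mul0r. Qed.

Lemma integralDr a : {morph integral a : X Y / X + Y}.
Proof.
move=> X Y; apply/funext => m; rewrite seqD /integral -big_split /=.
by apply: eq_bigr => k _; rewrite seqD mulrDr.
Qed.

Lemma integralZr a c : {morph integral a : X / c *: X}.
Proof.
move=> X; apply/funext => m; rewrite seqZ /integral scaler_sumr.
by apply: eq_bigr => k _; rewrite seqZ scalerAr.
Qed.

Lemma integral0r a : integral a 0 = 0.
Proof. by apply/funext => m; rewrite /integral big1 // => k _; rewrite mulr0. Qed.

(* The quasi-shuffle relation: the double sum over [u, u'] is split according
   to [u > u'], [u < u'] and [u = u']. *)
Lemma integralM a b X Y :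
  integral a X * integral b Y =
    integral a (X * integral b Y) + integral b (integral a X * Y)
    + integral (a * b) (X * Y).
Proof.
apply/funext; elim=> [|m IH]; first by rewrite !seqD seqM !integral_0 mul0r !addr0.
move: IH; rewrite !seqD ![(integral a X * integral b Y) _]seqM => IH.
rewrite !integralS dilateM // mulrDl !mulrDr IH !seqM.
ring.
Qed.

End RotaBaxter.

(** * Products of nested sums *)

Section QuasiShuffle.
Context {R : realType} {N : nat}.
Implicit Types (f g h : fps R) (X Y W : nat -> fps R) (w : word N).

(** The truncated bracket with u_1 <= m; the truncation is what lets the next outer summation impose
    strict decrease. *)
Fixpoint nested w : nat -> fps R :=
  if w is l :: w' then integral (pospart (letter l.1.-1 l.2)) (nested w') else 1.

Definition nested_span : (nat -> fps R) -> Prop :=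
  qspan N (fun X => exists w, positive_word w /\ X = nested w).

Lemma nested_span_submodule : submodule N nested_span.
Proof. exact: qspan_submodule. Qed.

Lemma nested_span_integral h X :
  expoly (N := N) h -> nested_span X -> nested_span (integral (pospart h) X).
Proof.
move=> + TX; move: h; apply: qspan_sub => [|_ [k [a ->]]].
  apply: submodule_preim nested_span_submodule _ _ _ => [|f g|c f].
  - by rewrite pospart0 integral0l.
  - by rewrite pospartD integralDl.
  by rewrite pospartZ integralZl.
move: X TX; apply: qspan_sub => [|_ [w [pw ->]]].
  apply: submodule_preim nested_span_submodule _ _ _ => [|f g|c f].
  - by rewrite integral0r.
  - by rewrite integralDr.
  by rewrite integralZr.
by apply: qspan_gen; exists ((k.+1, a) :: w).
Qed.

Lemma submodule_mulr (P : (nat -> fps R) -> Prop) Y :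
  submodule N P -> submodule N (fun X => P (X * Y)).
Proof.
move=> sP; apply: submodule_preim sP _ _ _ => [|f g|c f]; first by rewrite mul0r.
  by rewrite mulrDl.
by apply/funext => m; rewrite seqM !seqZ seqM scalerAl.
Qed.

Lemma nested_spanM X Y : nested_span X -> nested_span Y -> nested_span (X * Y).
Proof.
have sT := nested_span_submodule.
move=> + TY; move: X; apply: qspan_sub => [|_ [w [pw ->]]]; first exact: submodule_mulr.
rewrite mulrC; move: Y TY; apply: qspan_sub => [|_ [v [pv ->]]].
  exact: submodule_mulr.
(* Every term of [integralM] leaves inner words of smaller total length: a letter is removed from
   [v], from [w], or from both. *)
have [n] := ubnP (size v + size w); elim: n => // n IH in v w pv pw *.
case: v pv => [|[s a] v] /= pv lt_n.
  by rewrite mul1r; apply: qspan_gen; exists w.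
case: w pw lt_n => [|[t b] w] /= pw lt_n.
  by rewrite mulr1; apply: qspan_gen; exists ((s, a) :: v).
have [/andP[s0 pv'] /andP[t0 pw']] := (pv, pw).
rewrite integralM. 
have [h [Eh -> _]] := expoly_mul (expoly_letter (R := R) s.-1 a) (expoly_letter t.-1 b).
apply: (submodD sT); first apply: (submodD sT).
- apply: nested_span_integral; first exact: expoly_letter.
  by rewrite -[integral _ _]/(nested ((t, b) :: w)); apply: IH.
- apply: nested_span_integral; first exact: expoly_letter.
  rewrite -[integral _ _]/(nested ((s, a) :: v)); apply: IH => //.
  by rewrite /= addSn -addnS.
apply: nested_span_integral => //; apply: IH => //.
by move: lt_n; rewrite addSn addnS => /ltnSE/ltnW.
Qed.

(** The condition at 0 captures both families of generators: n^(s_1 - 1) vanishes at 0 for s_1 > 1,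
    and the two values 1 cancel in [gbeta]. *)
Definition regular X : Prop :=
  exists h Y, [/\ expoly (N := N) h, h 0%N = 0, nested_span Y &
    X = integral (pospart h) Y].

Definition regular_span : (nat -> fps R) -> Prop :=
  qspan N (fun X => X = 1 \/ regular X).

Lemma regular_span_submodule : submodule N regular_span.
Proof. exact: qspan_submodule. Qed.

(** Two terms of [integralM] keep the outermost letter of one factor; the third has the merged
    letter, whose value at 0 is minus a product of zeros. The inner parts need only lie in
    [nested_span]. *)
Lemma regular_spanM X Y : regular_span X -> regular_span Y -> regular_span (X * Y).
Proof.
have sT := regular_span_submodule.
move=> + TY; move: X; apply: qspan_sub => [|X GX]; first exact: submodule_mulr.
rewrite mulrC; move: Y TY; apply: qspan_sub => [|Y GY]; first exact: submodule_mulr.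
case: GX => [->|rX]; first by rewrite mulr1; apply: qspan_gen.
case: GY => [->|rY]; first by rewrite mul1r; apply: qspan_gen; right.
case: rX rY => [h [X' [Eh h0 TX ->]]] [g [Y' [Eg g0 TY ->]]].
rewrite integralM; have [k [Ek -> k0]] := expoly_mul Eg Eh.
apply: (submodD sT); first apply: (submodD sT); apply: qspan_gen; right.
- exists g, (Y' * integral (pospart h) X'); split=> //.
  by apply: nested_spanM => //; apply: nested_span_integral.
- exists h, (integral (pospart g) Y' * X'); split=> //.
  by apply: nested_spanM => //; apply: nested_span_integral.
exists k, (Y' * X'); split=> //; last exact: nested_spanM.
by rewrite k0 g0 mul0r oppr0.
Qed.

End QuasiShuffle.

(** * Coefficients of products of dilated series *)

Section Expansion.
Context {R : realType}.
Implicit Types (f g : fps R) (k n d : nat).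

Definition qpow k : fps R := fun n => (n == k)%:R.

Lemma qpowM k f n : (qpow k * f) n = if (k <= n)%N then f (n - k)%N else 0.
Proof.
rewrite fpsM; case: leqP => [kn|nk].
  rewrite (bigD1 (Ordinal (kn : (k < n.+1)%N))) //= /qpow eqxx mul1r big1 ?addr0 //.
  by move=> i; rewrite -val_eqE /= => /negPf ->; rewrite mul0r.
rewrite big1 // => i _; rewrite /qpow.
by have /negPf -> := ltn_eqF (leq_ltn_trans (leq_ord i) nk); rewrite mul0r.
Qed.

Lemma qpowD : {morph qpow : k l / (k + l)%N >-> k * l}.
Proof.
move=> k l; apply/funext => n; rewrite qpowM /qpow; case: leqP => [kn|nk].
  by rewrite -{1}(subnKC kn) eqn_add2l.
by rewrite ltn_eqF // (leq_trans nk) ?leq_addr.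
Qed.

Lemma coef_prod_dilate d n (u : {ffun 'I_d -> 'I_n.+1}) (A : 'I_d -> fps R) :
  (forall j, 0 < u j)%N ->
  (\prod_j dilate (u j) (A j)) n =
    \sum_(v : {ffun 'I_d -> 'I_n.+1} | (\sum_(j < d) u j * v j == n)%N)
      \prod_j A j (v j).
Proof.
move=> u0.
transitivity ((\prod_j \sum_(v < n.+1) A j v *: qpow (u j * v)) n).
  (* Agreement in all degrees up to [n] is stable under products. Cutting v_j off at [n] is harmless
     there because u_j >= 1. *)
  suff: forall i, (i <= n)%N -> (\prod_j dilate (u j) (A j)) i =
      (\prod_j \sum_(v < n.+1) A j v *: qpow (u j * v)) i by apply.
  elim/big_ind2: _ => // [f f' g g' ef eg i ni|j _ i ni].
    rewrite !fpsM; apply: eq_bigr => k _.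
    by rewrite ef ?eg // (leq_trans _ ni) ?leq_subr ?leq_ord.
  rewrite fps_sum /dilate; case: ifPn => [/dvdnP[m im]|ni'].
    have mn : (m < n.+1)%N by rewrite ltnS (leq_trans _ ni) // im leq_pmulr.
    rewrite im mulnK // (bigD1 (Ordinal mn)) //= fpsZ /qpow mulnC eqxx mulr1.
    rewrite big1 ?addr0 // => k; rewrite -val_eqE fpsZ /= => km.
    by rewrite eqn_pmul2l // eq_sym (negPf km) mulr0.
  rewrite big1 // => k _; rewrite fpsZ /qpow; case: eqP => [e|]; last by rewrite mulr0.
  by rewrite e dvdn_mulr in ni'.
rewrite bigA_distr_bigA fps_sum [RHS]big_mkcond /=; apply: eq_bigr => v _.
have -> : \prod_i (A i (v i) *: qpow (u i * v i)) =
    (\prod_i A i (v i)) *: qpow (\sum_(i < d) u i * v i)%N.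
  rewrite (big_morph qpow qpowD (erefl : qpow 0 = 1)).
  by elim/big_rec3: _ => [|i x y z _ ->]; rewrite ?scale1r // -scalerAl -scalerAr scalerA.
by rewrite fpsZ /qpow eq_sym; case: eqP; rewrite ?mulr1 ?mulr0.
Qed.

End Expansion.

(** * Splitting off the first entry of an index tuple *)

Section FfunCons.
Context {T : finType} {d : nat}.

Definition ffun_cons (t : T) (u : {ffun 'I_d -> T}) : {ffun 'I_d.+1 -> T} :=
  [ffun i => oapp u t (unlift ord0 i)].

Lemma ffun_cons0 t u : ffun_cons t u ord0 = t.
Proof. by rewrite ffunE unlift_none. Qed.

Lemma ffun_consS t u j : ffun_cons t u (lift ord0 j) = u j.
Proof. by rewrite ffunE liftK. Qed.

Lemma sum_ffun_cons (V : nmodType) (P : pred {ffun 'I_d.+1 -> T})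
    (F : {ffun 'I_d.+1 -> T} -> V) :
  \sum_(u | P u) F u = \sum_t \sum_(u | P (ffun_cons t u)) F (ffun_cons t u).
Proof.
rewrite pair_big_dep /= (reindex (fun p => ffun_cons p.1 p.2)) //=.
exists (fun u => (u ord0, [ffun j => u (lift ord0 j)])) => [[t u] _|u _] /=.
  rewrite ffun_cons0; congr (_, _); apply/ffunP => j.
  by rewrite ffunE ffun_consS.
apply/ffunP => i; case: (unliftP ord0 i) => [j|] ->.
  by rewrite ffun_consS ffunE.
by rewrite ffun_cons0.
Qed.

End FfunCons.

(** * Brackets as limits of nested sums *)

Section Limit.
Context {R : realType} {N : nat}.
Implicit Types (f g h : fps R) (X Y : nat -> fps R) (w : word N) (n m : nat).

(** The coefficientwise limit when [X] is [stable], since the n-th coefficient is then constant from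
    index n on. *)
Definition limit X : fps R := fun n => X n n.

Definition stable X : Prop := forall n m, (n <= m)%N -> X m n = X n n.

Lemma limitM X Y : stable X -> stable Y -> limit (X * Y) = limit X * limit Y.
Proof.
move=> sX sY; apply/funext => n; rewrite /limit seqM !fpsM.
by apply: eq_bigr => i _; rewrite sX ?leq_ord // sY ?leq_subr.
Qed.

Lemma stable_submodule : submodule N stable.
Proof.
split=> // [X Y sX sY|c X _ sX] n m nm; first by rewrite !seqD !fpsD sX ?sY.
by rewrite !seqZ !fpsZ sX.
Qed.

(** The summand added in passing to m + 1 starts in degree m + 1, as [pospart] removes the constant
    term. *)
Lemma stable_integral h X : stable (integral (pospart h) X).
Proof.
move=> n; elim=> [|m IH]; first by rewrite leqn0 => /eqP ->.
rewrite leq_eqVlt => /orP[/eqP -> //|]; rewrite ltnS => nm.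
rewrite integralS fpsD IH // fpsM big1 ?addr0 // => i _.
rewrite /dilate; case: ifP => [/dvdnP[k ik]|]; last by rewrite mul0r.
case: k ik => [|k] ik; first by rewrite ik div0n mul0r.
have := leq_ltn_trans (leq_ord i) (leq_ltn_trans nm (ltnSn m)).
by rewrite ik mulSn ltnNge leq_addr.
Qed.

Lemma stable_regular_span X : regular_span (N := N) X -> stable X.
Proof.
apply: (qspan_sub stable_submodule) => _ [->//|[h [Y [_ _ _ ->]]]].
exact: stable_integral.
Qed.

Definition decreasing_below d n m (u : {ffun 'I_d -> 'I_n.+1}) : bool :=
  [&& [forall i : 'I_d, forall j : 'I_d, (i < j)%N ==> (u j < u i)%N],
      [forall j, (0 < u j)%N] & [forall j, (u j <= m)%N]].

Lemma decreasing_below_cons d n m (t : 'I_n.+1) (u : {ffun 'I_d -> 'I_n.+1}) :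
  decreasing_below m (ffun_cons t u) =
    (0 < t <= m)%N && decreasing_below t.-1 u.
Proof.
apply/and3P/andP => [[/forallP D /forallP P /forallP B]|].
  have t0 : (0 < t)%N by have := P ord0; rewrite ffun_cons0.
  have tm : (t <= m)%N by have := B ord0; rewrite ffun_cons0.
  split; first by rewrite t0 tm.
  apply/and3P; split; apply/forallP => i; first apply/forallP => j.
  - by have /forallP/(_ (lift ord0 j)) := D (lift ord0 i); rewrite !ffun_consS.
  - by have := P (lift ord0 i); rewrite ffun_consS.
  have /forallP/(_ (lift ord0 i)) := D ord0.
  by rewrite ffun_cons0 ffun_consS /= => ut; rewrite -ltnS prednK.
case=> /andP[t0 tm] /and3P[/forallP D /forallP P /forallP B].
have ut j : (u j < t)%N by rewrite -(prednK t0) ltnS.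
split; apply/forallP => i; case: (unliftP ord0 i) => [i'|] ->.
- apply/forallP => j; case: (unliftP ord0 j) => [j'|] -> //.
  by have /forallP/(_ j') := D i'; rewrite !ffun_consS.
- apply/forallP => j; case: (unliftP ord0 j) => [j'|] -> //.
  by rewrite ffun_cons0 ffun_consS ut implybT.
- by rewrite ffun_consS.
- by rewrite ffun_cons0.
- by rewrite ffun_consS (leq_trans (ltnW (ut _))).
by rewrite ffun_cons0.
Qed.

(** The index range is fixed by [n], while the bound [m] drops to u_1 - 1 in the induction. *)
Lemma nested_expansion n m w : (m <= n)%N ->
  nested (R := R) w m =
    \sum_(u : {ffun 'I_(size w) -> 'I_n.+1} | decreasing_below m u)
      \prod_j dilate (u j)
        (pospart (letter (tnth (in_tuple w) j).1.-1 (tnth (in_tuple w) j).2)).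
Proof.
elim: w m => [|l w IH] m mn.
  rewrite (bigD1 [ffun => ord0]) /=; last first.
    by apply/and3P; split; apply/forallP => -[].
  rewrite big_ord0 big1 ?addr0 // => u /andP[_ /eqP[]].
  by apply/ffunP => -[].
rewrite sum_ffun_cons /= /integral.
under [RHS]eq_bigr => t _.
  under eq_bigl do rewrite decreasing_below_cons.
  under eq_bigr => u _.
    rewrite big_ord_recl ffun_cons0 {1 2}(tnth_nth l) /=.
    under eq_bigr => j _ do rewrite ffun_consS !(tnth_nth l) /=.
    over.
  over.
(* The value u_1 = 0 contributes nothing; u_1 = k + 1 matches the k-th summand of [integral]. *)
rewrite big_ord_recl big_pred0 // add0r.
rewrite (big_ord_widen n
  (fun k => dilate k.+1 (pospart (letter l.1.-1 l.2)) * nested w k)) //.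
rewrite big_mkcond /=; apply: eq_bigr => k _.
rewrite /bump /= add1n; case: ltnP => km; last by rewrite big_pred0.
rewrite (IH k) ?mulr_sumr; last exact: ltnW.
by apply: eq_bigr => u _; congr (_ * _); apply: eq_bigr => j _; rewrite !(tnth_nth l).
Qed.

Lemma bracketE w : bracket R w = limit (nested w).
Proof.
apply/funext => n; rewrite /limit (nested_expansion w (leqnn n)) fps_sum /bracket.
rewrite mulr_sumr [RHS]big_mkcond /=; apply: eq_bigr => u _.
rewrite /decreasing_below; have -> : [forall j, (u j <= n)%N].
  by apply/forallP => j; exact: leq_ord.
rewrite andbT; case: ifP => [/andP[-> pu]|nu]; last first.
  by rewrite [X in _ * X]big_pred0 ?mulr0 // => v; rewrite [in X in _ && X]andbA nu andbF.
rewrite coef_prod_dilate; last exact/forallP.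
rewrite pu mulr_sumr /=.
rewrite big_mkcondr /=; apply: eq_bigr => v _; case: ifPn => [/forallP pv|].
  rewrite -prodrXr -prodfV -!big_split /=; apply: eq_bigr => j _.
  have := pv j; case: (nat_of_ord (v j)) => // k _.
  by rewrite /pospart /letter fpsZ /monomial /zeta -exprM.
(* The expansion admits tuples v with a zero entry; [pospart] annihilates them. *)
rewrite negb_forall => /existsP[j]; rewrite -eqn0Ngt => /eqP vj.
by rewrite (bigD1 j) //= vj mul0r.
Qed.

End Limit.

(** * Identification of [qMZ] with limits of regular sums *)

Section Regular.
Context {R : realType} {N : nat}.
Implicit Types (f g h : fps R) (X Y : nat -> fps R) (w : word N).
Local Notation qMZ_span := (qspan N (qMZ_gen R N)).

Lemma limit_submodule (P : fps R -> Prop) :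
  submodule N P -> submodule N (fun X => P (limit X)).
Proof. by move=> sP; apply: submodule_preim sP _ _ _. Qed.

Lemma letter_coef0 k (a : 'I_N.-1.+1) : letter k a 0%N = (k == 0)%:R :> R[i].
Proof.
rewrite /letter fpsZ /monomial expr0 mul1r expr0n.
by case: k => [|k]; rewrite ?mulr0 // invr1 mul1r.
Qed.

Lemma qMZ_bracket (s : nat) (a : 'I_N.-1.+1) w : (1 < s)%N -> positive_word w ->
  qMZ_span (bracket R ((s, a) :: w)).
Proof. by move=> s1 pw; apply: qspan_gen; left; right; exists s, a, w. Qed.

(* The correction term turns each [[1, s; a, alpha]] into minus a [gbeta]. *)
Lemma qMZ_integral h Y : expoly (N := N) h -> nested_span (N := N) Y ->
  qMZ_span (limit (integral (pospart h) Y)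
    - h 0%N *: limit (integral (pospart (letter 0 (0 : 'I_N.-1.+1))) Y)).
Proof.
have sQ := qspan_submodule (N := N) (qMZ_gen R N).
move=> + TY; move: h; apply: qspan_sub => [|_ [k [a ->]]].
  apply: (@submodule_preim _ _ _ _ (fun h => limit (integral (pospart h) Y)
    - h 0%N *: limit (integral (pospart (letter 0 0)) Y)) _ sQ) => [|f g|c f].
  - by rewrite pospart0 integral0l fps0 scale0r subr0.
  - by rewrite pospartD integralDl fpsD scalerDl opprD addrACA.
  by rewrite pospartZ integralZl fpsZ -scalerA scalerBr.
move: Y TY; apply: qspan_sub => [|_ [w [pw ->]]].
  apply: (@submodule_preim _ _ _ _ (fun Y => limit (integral (pospart (letter k a)) Y)
    - letter k a 0%N *: limit (integral (pospart (letter 0 0)) Y)) _ sQ) => [|X Y|c X].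
  - by rewrite !integral0r scaler0 subr0.
  - by rewrite !integralDr scalerDr opprD addrACA.
  by rewrite !integralZr scalerBr scalerA mulrC -scalerA.
have e b i : limit (integral (pospart (letter i b)) (nested w)) =
    bracket R ((i.+1, b) :: w) by rewrite bracketE.
rewrite !e letter_coef0; case: k => [|k] /=; last first.
  by rewrite scale0r subr0; apply: qMZ_bracket.
rewrite scale1r; have [->|a0] := eqVneq a 0; first by rewrite subrr; apply: (submod0 sQ).
rewrite -opprB -scaleN1r; apply: (submodZ sQ); first exact/QNN/QN1.
by apply: qspan_gen; right; exists a, w.
Qed.

Lemma qMZ_limit X : regular_span (N := N) X -> qMZ_span (limit X).
Proof.
have sQ := qspan_submodule (N := N) (qMZ_gen R N).
move: X; apply: qspan_sub => [|_ [->|[h [Y [Eh h0 TY ->]]]]].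
- exact: limit_submodule.
- by apply: qspan_gen; left; left; rewrite bracketE.
by have := qMZ_integral Eh TY; rewrite h0 scale0r subr0.
Qed.

(** Multiplication is carried out on such lifts, where the quasi-shuffle relation holds before the
    limit. *)
Lemma qMZ_lift f : qMZ_span f -> exists2 X, regular_span (N := N) X & limit X = f.
Proof.
have sT := regular_span_submodule (R := R) (N := N).
move: f; apply: qspan_sub => [|f Gf].
  split=> [|f g [X rX <-] [Y rY <-]|c f Kc [X rX <-]].
    by exists 0; first exact: (submod0 sT).
    by exists (X + Y); first exact: (submodD sT).
  by exists (c *: X); first exact: (submodZ sT).
have nest w : positive_word w -> nested_span (N := N) (nested (R := R) w).
  by move=> pw; apply: qspan_gen; exists w.
case: Gf => [[->|[s [a [w [s1 pw ->]]]]]|[b [w [b0 pw ->]]]].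
- by exists 1; [apply: qspan_gen; left|rewrite bracketE].
- exists (nested ((s, a) :: w)); last by rewrite bracketE.
  apply: qspan_gen; right; exists (letter s.-1 a), (nested w).
  split; rewrite ?letter_coef0 ?eqn0Ngt; [exact: expoly_letter| |exact: nest|by []].
  by case: s s1 => [|[]].
pose h : fps R := letter 0 (0 : 'I_N.-1.+1) - letter 0 b.
exists (integral (pospart h) (nested w)).
  apply: qspan_gen; right; exists h, (nested w).
  split; [|by rewrite /h fpsB !letter_coef0 subrr|exact: nest|by []].
  by apply: (submodB expoly_submodule); exact: expoly_letter.
rewrite /h pospartB integralDl -scaleN1r integralZl scaleN1r.
by apply/funext => n; rewrite /gbeta !bracketE.
Qed.

End Regular.

(** * The subalgebra property *)

Theorem theorem6p8 (R : realType) (N : nat) (hN : (1 <= N)%N) :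
  QN_subalgebra N (qMZ R N) (MD R N).
Proof.
have sQ := qspan_submodule (N := N) (qMZ_gen R N).
pose G (f : fps R) := exists w : word N, positive_word w /\ f = bracket R w.
have sM := qspan_submodule (N := N) G.
have MDgen (w : word N) : positive_word w -> qspan N G (bracket R w).
  by move=> pw; apply: qspan_gen; exists w.
split.
- move=> f /QN_spanP Qf; apply/QN_spanP; move: f Qf; apply: qspan_sub => // f.
  case=> [[->|[s [a [w [s1 pw ->]]]]]|[b [w [_ pw ->]]]]; first exact: MDgen.
    by apply: MDgen; rewrite /= (ltnW s1).
  by apply: (submodB sM); apply: MDgen.
- apply/QN_spanP; apply: qspan_gen; left; left.
  by apply/funext => n; rewrite bracket_nil.
- by move=> f g /QN_spanP Qf /QN_spanP Qg; apply/QN_spanP; exact: (submodD sQ).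
- by move=> c f Kc /QN_spanP Qf; apply/QN_spanP; exact: (submodZ sQ).
(* Regular lifts are stable, so [limit] is multiplicative on them and closure reduces to
   [regular_spanM]. *)
move=> f g /QN_spanP/qMZ_lift[X rX <-] /QN_spanP/qMZ_lift[Y rY <-]; apply/QN_spanP.
have -> : fps_mul (limit X) (limit Y) = limit (X * Y).
  by rewrite (limitM (stable_regular_span rX) (stable_regular_span rY)).
exact/qMZ_limit/regular_spanM.
Qed.
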